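(* Let $f:\{0,1\}^n\to\{0,1\}$. Then: (1) $\widehat{S}(f)\le S(f)$, $\widehat{C}(f)\le C(f)$, $\widehat{P}(f)\le P(f)$, $\widehat{C}(f)\le \widehat{P}(f)$, and $C(f)\le P(f)$; (2) $P(f)/2\le S(f)\le 2^{C(f)}$; (3) $S(f)=O(2^n/n)$ and $P(f)\le 2^{n/2+1}$; (4) for every $\delta>1$, most Boolean functions $f$ on $n$ variables satisfy $\widehat{S}(f)\ge 2^n/n^\delta$ (i.e. the fraction of such $f$ tends to $1$ as $n\to\infty$); (5) most Boolean functions $f$ on $n$ variables satisfy $\widehat{C}(f)\ge\Omega(2^{n/2}/\log n)$.
   Context: For $g:\{0,1\}^n\to\mathbb{N}$ and $A\subseteq[n]$, $g_A$ is the $2^{|A|}\times 2^{n-|A|}$ matrix with rows indexed by $\alpha\in\{0,1\}^A$, columns by $\beta\in\{0,1\}^{[n]\setminus A}$, entry $g(\alpha,\beta)$. $\mathsf{nrows}(g_A)$ is the number of distinct rows, $\mathsf{mult}(g_A)$ the number of occurrences of a most frequent row. $S(f)=\max_{1\le k\le n}\min_{|A|=k}\mathsf{nrows}(f_A)$ and $\widehat{S}(f)=\max_{1\le k\le n}\min_{|A|=k}2^k/\mathsf{mult}(f_A)$. A matrix $M\in\mathbb{N}^{a\times b}$ is a rectangle if $M(i,j)=g_ih_j$ with $g\in\{0,1\}^a,h\in\mathbb{N}^b$; $g$ is an $A$-rectangle if $g_A$ is a rectangle, and a $k$-rectangle if it is an $A$-rectangle for some $|A|=k$. $C(f,A)$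 (resp. $C(f,k)$) is the least $r$ such that $f$ is the Boolean OR of $r$ Boolean $A$-rectangles (resp. $k$-rectangles); $C(f)=\max_k\min_{|A|=k}C(f,A)$, $\widehat{C}(f)=\max_k C(f,k)$. Functions $g,h$ are orthogonal if $g\cdot h\equiv0$. $P^+(g,A)$ (resp. $P^+(g,k)$) is the least $r$ such that $g$ is the integer sum of $r$ pairwise orthogonal $A$-rectangles (resp. $k$-rectangles); $P(f)=\max_k\min_{|A|=k}\big(P^+(f,A)+P^+(\neg f,A)\big)$, $\widehat{P^+}(g)=\max_kP^+(g,k)$, $\widehat{P}(f)=\max\{\widehat{P^+}(f),\widehat{P^+}(\neg f)\}$. Logarithms are base 2. *)

(* Defs.v *)
From mathcomp Require Import all_boot all_order all_algebra.
From mathcomp Require Import all_classical all_reals all_analysis.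

Set Implicit Arguments.
Unset Strict Implicit.
Unset Printing Implicit Defensive.

Import Order.TTheory GRing.Theory Num.Theory.
Import numFieldNormedType.Exports.

Local Open Scope ring_scope.
Local Open Scope classical_set_scope.

Notation cube n := {ffun 'I_n -> bool}.
Notation bfun n := {ffun cube n -> bool}.

Notation rowix A := {ffun {i | i \in A} -> bool}.
Notation colix A := {ffun {i | i \notin A} -> bool}.

Section Communication.
Variables (n : nat) (A : {set 'I_n}).
Implicit Type g : cube n -> nat.

Definition glue (a : rowix A) (b : colix A) : cube n :=
  [ffun i => match boolP (i \in A) with
             | AltTrue iA => a (exist _ i iA)
             | AltFalse iNA => b (exist _ i iNA)
             end].

Definition comm_mx g (a : rowix A) (b : colix A) : nat := g (glue a b).

Definition comm_row g (a : rowix A) : {ffun colix A -> nat} :=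
  [ffun b => comm_mx g a b].

Definition nrows g : nat := size (undup [seq comm_row g a | a : rowix A]).

Definition mult g : nat :=
  \max_(a : rowix A) #|[set a' : rowix A | comm_row g a' == comm_row g a]%SET|.

End Communication.

(* The default argument of arg min has cardinality k as soon as k <= n, so in
   that range this is the minimum of F over all k-element sets. *)
Definition min_card (n k : nat) d (T : orderType d) (F : {set 'I_n} -> T) : T :=
  F [arg min_(A < [set i : 'I_n | (i < k)%N]%SET | #|A| == k) F A]%O.

(* Total version of the least element, equal to 0 on the empty set; the sets it
   is applied to are nonempty by decomposition_exists below. *)
Definition least (X : set nat) : nat := xget 0%N (X `&` lbound X).

Definition rectangle (I J : Type) (M : I -> J -> nat) : Prop :=
  exists (g : I -> bool) (h : J -> nat), forall i j, M i j = (g i * h j)%N.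

Section Complexity.
Variable n : nat.
Implicit Types (A : {set 'I_n}) (k : nat) (g h : cube n -> nat) (f : bfun n).
Implicit Types (rect : (cube n -> nat) -> Prop).

Definition set_rectangle A g : Prop := rectangle (comm_mx (A := A) g).

Definition card_rectangle k g : Prop :=
  exists2 A : {set 'I_n}, #|A| = k & set_rectangle A g.

Definition natf f : cube n -> nat := fun x => f x.

Definition negf f : bfun n := [ffun x => ~~ f x].

Definition orthogonalf g h : Prop := forall x, (g x * h x)%N = 0%N.

Definition or_decompositions rect f : set nat :=
  [set r | exists F : 'I_r -> bfun n,
     (forall i, rect (natf (F i))) /\ (forall x, f x = [exists i, F i x])].

Definition sum_decompositions rect g : set nat :=
  [set r | exists F : 'I_r -> cube n -> nat,
     [/\ forall i, rect (F i),
         forall (i j : 'I_r), i != j -> orthogonalf (F i) (F j)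
       & forall x, g x = (\sum_(i < r) F i x)%N]].

Definition cplxC_set f A : nat :=
  least (or_decompositions (set_rectangle A) f).

Definition cplxC_card f k : nat :=
  least (or_decompositions (card_rectangle k) f).

Definition Pplus_set g A : nat :=
  least (sum_decompositions (set_rectangle A) g).

Definition Pplus_card g k : nat :=
  least (sum_decompositions (card_rectangle k) g).

Definition cplxS f : nat :=
  (\max_(1 <= k < n.+1) min_card k (fun A => nrows A (natf f)))%N.

Definition cplxShat f : rat :=
  \big[Num.max/0]_(1 <= k < n.+1)
    min_card k (fun A => 2 ^+ k / (mult A (natf f))%:R).

Definition cplxC f : nat :=
  (\max_(1 <= k < n.+1) min_card k (cplxC_set f))%N.

Definition cplxChat f : nat := (\max_(1 <= k < n.+1) cplxC_card f k)%N.

Definition cplxP f : nat :=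
  (\max_(1 <= k < n.+1)
     min_card k (fun A =>
       Pplus_set (natf f) A + Pplus_set (natf (negf f)) A))%N.

Definition Pplushat g : nat := (\max_(1 <= k < n.+1) Pplus_card g k)%N.

Definition cplxPhat f : nat :=
  maxn (Pplushat (natf f)) (Pplushat (natf (negf f))).

End Complexity.

Lemma leastP (X : set nat) : X !=set0 ->
  X (least X) /\ forall m, X m -> (least X <= m)%N.
Proof.
move=> [m0 Xm0].
have exX : exists m, `[< X m >] by exists m0; apply/asboolP.
have [m /asboolP Xm mmin] := ex_minnP exX.
suff [? lb] : (X `&` lbound X) (least X).
  by split=> // k Xk; have := lb k Xk.
apply: (@xgetPex _ 0%N _); exists m; split=> // k Xk.
by apply: mmin; apply/asboolP.
Qed.


Lemma glueK n (A : {set 'I_n}) (a : rowix A) (b : colix A) :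
  [ffun u : {i | i \in A} => glue a b (val u)] = a.
Proof.
apply/ffunP => -[i iA]; rewrite !ffunE /=.
match goal with |- context [boolP ?p] => destruct (boolP p) as [iA'|iNA] end.
  by congr (a _); apply: val_inj.
by case/negP: iNA.
Qed.

Lemma decomposition_exists n (A : {set 'I_n}) (f : bfun n) (g : cube n -> nat) :
  [/\ or_decompositions (set_rectangle A) f !=set0,
      or_decompositions (card_rectangle #|A|) f !=set0,
      sum_decompositions (set_rectangle A) g !=set0
    & sum_decompositions (card_rectangle #|A|) g !=set0].
Proof.
pose rho (x : cube n) : rowix A := [ffun u => x (val u)].
pose G (i : 'I_#|{: rowix A}|) (x : cube n) : bool := enum_rank (rho x) == i.
have GE i x : G i x = (rho x == enum_val i).
  by rewrite /G -(inj_eq enum_val_inj) enum_rankK.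
have rect m (i : 'I_#|{: rowix A}|) :
    set_rectangle A (fun x : cube n => (G i x * m x)%N).
  exists (fun a => a == enum_val i), (fun b => m (glue (enum_val i) b)) => a b.
  rewrite /comm_mx GE /rho glueK.
  by case: eqP => [->|]; rewrite ?mul1n ?mul0n.
have rectb (i : 'I_#|{: rowix A}|) :
    set_rectangle A (natf [ffun x => G i x && f x]).
  have [p [q pq]] := rect (natf f) i; exists p, q => a b.
  by rewrite -pq /comm_mx /natf ffunE mulnb.
have orD x : f x = [exists i, [ffun x => G i x && f x] x].
  apply/idP/existsP => [fx|[i]]; last by rewrite ffunE => /andP[].
  by exists (enum_rank (rho x)); rewrite ffunE /G eqxx.
have orth i j : i != j -> orthogonalf (fun x => (G i x * g x)%N)
                                      (fun x => (G j x * g x)%N).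
  move=> ij x; rewrite /G; case: eqP => [->|]; last by rewrite !mul0n.
  by rewrite (negbTE ij) mul0n muln0.
have sumD x : g x = (\sum_i G i x * g x)%N.
  rewrite (bigD1 (enum_rank (rho x))) //= big1 /G ?eqxx ?mul1n ?addn0 //.
  by move=> i; rewrite eq_sym => /negbTE ->.
split; exists #|{: rowix A}|.
- by exists (fun i => [ffun x => G i x && f x]).
- by exists (fun i => [ffun x => G i x && f x]); split=> // i; exists A.
- by exists (fun i x => (G i x * g x)%N).
- by exists (fun i x => (G i x * g x)%N); split=> // i; exists A.
Qed.

Definition log2 (R : realType) (x : R) : R := ln x / ln 2.

Definition most (R : realType) (Q : forall n, pred (bfun n)) : Prop :=
  (fun n => #|Q n|%:R / #|{: bfun n}|%:R : R) @ \oo --> (1 : R).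

(* Main.v *)
Require Import Defs.
From mathcomp Require Import all_boot all_order all_algebra.
From mathcomp Require Import all_classical all_reals all_analysis.
From mathcomp Require Import zify.

(* Parts (1)-(3) compare, for a fixed A, the rows of f_A with its rectangle
   decompositions: grouping equal rows gives P^+ <= nrows, a row is determined by
   the rectangles of an OR-decomposition it meets, and f_A has at most
   min(2^|A|, 2^2^(n-|A|)) distinct rows.

   For (4) take |A| = n - j with 4n <= 2^j < 8n. Two given rows of f_A agree with
   probability 2^-(2^j), so by a union bound over A and pairs of rows, with
   probability at least 1 - 2^-n all rows of every f_A are distinct, and then
   Shat(f) >= 2^(n-j) > 2^n / 8n.

   For (5) take k = n/2 rounded down. There are only 2^O(2^(n/2)) Boolean
   k-rectangles, hence 2^O(r 2^(n/2)) disjunctions of r of them, so most f need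
   Omega(2^(n/2)) rectangles; this is even stronger than the stated bound. *)

Set Implicit Arguments.
Unset Strict Implicit.
Unset Printing Implicit Defensive.

Import Order.TTheory GRing.Theory Num.Theory.
Import numFieldNormedType.Exports.

Local Open Scope ring_scope.

(** * Maxima over k, minima over k-element sets, least elements *)

Lemma leq_max_nat (n : nat) (F : nat -> nat) (k : nat) :
  (0 < k <= n)%N -> (F k <= \max_(1 <= i < n.+1) F i)%N.
Proof.
by move=> kn; apply: (@leq_bigmax_seq _ (index_iota 1 n.+1)); rewrite ?mem_index_iota.
Qed.

Lemma max_nat_leq (n : nat) (F : nat -> nat) (m : nat) :
  (forall k, (0 < k <= n)%N -> (F k <= m)%N) ->
  (\max_(1 <= i < n.+1) F i <= m)%N.
Proof.
by move=> Fm; apply/bigmax_leqP_seq => k + _; rewrite mem_index_iota; exact: Fm.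
Qed.

Lemma min_cardP (n k : nat) d (T : orderType d) (F : {set 'I_n} -> T) :
  (k <= n)%N ->
  (exists2 A : {set 'I_n}, #|A| = k & min_card k F = F A) /\
  (forall A : {set 'I_n}, #|A| = k -> (min_card k F <= F A)%O).
Proof.
move=> kn; rewrite /min_card.
have k0 : #|[set i : 'I_n | (i < k)%N]%SET| == k.
  have -> : [set i : 'I_n | (i < k)%N]%SET = [set widen_ord kn i | i : 'I_k]%SET.
    apply/setP => i; rewrite inE; apply/idP/imsetP => [ik|[j _ ->]]; last exact: (ltn_ord j).
    by exists (Ordinal ik) => //; exact: val_inj.
  rewrite card_imset ?card_ord // => i j ij.
  by apply: val_inj; have /(congr1 val) := ij.
case: arg_minP => // A /eqP Ak Amin; split; first by exists A.
by move=> B /eqP; exact: Amin.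
Qed.

Lemma exists_card_set (n k : nat) :
  (k <= n)%N -> exists A : {set 'I_n}, #|A| = k.
Proof. by move=> /(min_cardP (fun=> 0%N))[[A Ak _] _]; exists A. Qed.

Lemma min_card_leq (n k : nat) (F : {set 'I_n} -> nat) (A : {set 'I_n}) :
  #|A| = k -> (min_card k F <= F A)%N.
Proof.
move=> Ak; have kn : (k <= n)%N by rewrite -Ak -[n in (_ <= n)%N]card_ord max_card.
by rewrite -leEnat; apply: (min_cardP _ kn).2.
Qed.

Lemma le_min_max (n : nat) (G H : nat -> {set 'I_n} -> nat) :
  (forall k (A : {set 'I_n}), #|A| = k -> (G k A <= H k A)%N) ->
  (\max_(1 <= k < n.+1) min_card k (G k) <= \max_(1 <= k < n.+1) min_card k (H k))%N.
Proof.
move=> GH; apply: max_nat_leq => k /[dup] k1n /andP[_ kn].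
have [[A Ak HA] _] := min_cardP (H k) kn.
apply: leq_trans (leq_max_nat (fun k => min_card k (H k)) k1n).
by rewrite HA (leq_trans (min_card_leq _ Ak)) ?GH.
Qed.

Lemma least_leq (X : set nat) (m : nat) : X m -> (least X <= m)%N.
Proof. by move=> Xm; apply: (leastP _).2 => //; exists m. Qed.

Lemma leq_least (X : set nat) (m : nat) :
  (X !=set0)%classic -> (forall r, X r -> (m <= r)%N) -> (m <= least X)%N.
Proof. by move=> /leastP[Xl _]; apply. Qed.

(** * Splitting a point of the cube into row and column coordinates *)

Section Restriction.
Context {n : nat} (A : {set 'I_n}).

Definition rowpart (x : cube n) : rowix A := [ffun u => x (val u)].
Definition colpart (x : cube n) : colix A := [ffun u => x (val u)].

Lemma glue_parts x : Defs.glue (rowpart x) (colpart x) = x.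
Proof.
apply/ffunP => i; rewrite ffunE.
by match goal with |- context [boolP ?p] => destruct (boolP p) as [?|?] end;
  rewrite ffunE.
Qed.

Lemma rowpart_glue a b : rowpart (Defs.glue a b) = a.
Proof. exact: Defs.glueK. Qed.

Lemma colpart_glue a b : colpart (Defs.glue a b) = b.
Proof.
apply/ffunP => -[i iA]; rewrite !ffunE /=.
match goal with |- context [boolP ?p] => destruct (boolP p) as [iA'|iNA] end.
  by exfalso; case/negP: iA.
by congr (b _); apply: val_inj.
Qed.

Lemma card_rowix : #|{: rowix A}| = (2 ^ #|A|)%N.
Proof. by rewrite card_ffun card_bool card_sig. Qed.

Lemma card_colix : #|{: colix A}| = (2 ^ (n - #|A|))%N.
Proof.
rewrite card_ffun card_bool card_sig -[n in (n - _)%N]card_ord -(cardC (mem A)) addKn.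
by congr (2 ^ _)%N; apply: eq_card.
Qed.

End Restriction.

Lemma card_bfun (n : nat) : #|{: bfun n}| = (2 ^ 2 ^ n)%N.
Proof. by rewrite !card_ffun !card_bool card_ord. Qed.

(** * Distinct rows, row multiplicity and partitions into rectangles *)

Section Rows.
Context {n : nat} (A : {set 'I_n}) (g : cube n -> nat).

Let rows := undup [seq comm_row g a | a : rowix A].

Let rows_mem a : comm_row g a \in rows.
Proof. by rewrite mem_undup map_f ?mem_enum. Qed.

(** Numbers the classes of equal rows by position in the list of distinct rows, so that the index
    type has exactly [nrows A g] elements. *)
Definition rowclass (a : rowix A) : 'I_(nrows A g) :=
  Ordinal (etrans (index_mem (comm_row g a) rows) (rows_mem a)).

Lemma rowclassP a : nth [ffun=> 0%N] rows (rowclass a) = comm_row g a.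
Proof. exact: nth_index. Qed.

(** All rows lie in the image of [h]. Each upper bound on [nrows] below comes from a choice of [psi]
    and [h]. *)
Lemma nrows_leq (T : finType) (psi : rowix A -> T) (h : T -> {ffun colix A -> nat}) :
  (forall a, comm_row g a = h (psi a)) -> (nrows A g <= #|T|)%N.
Proof.
move=> gE; rewrite -(size_codom h); apply: uniq_leq_size (undup_uniq _) _ => r.
by rewrite mem_undup => /mapP[a _ ->]; rewrite gE codom_f.
Qed.

Lemma nrows_leq_row : (nrows A g <= 2 ^ #|A|)%N.
Proof. by rewrite -card_rowix; exact: (nrows_leq (psi := id) (h := comm_row g)). Qed.

(** The row indices split into [nrows] classes of equal rows, each of size at most [mult]. *)
Lemma rows_mult : (2 ^ #|A| <= nrows A g * mult A g)%N.
Proof.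
rewrite -card_rowix -sum1_card (partition_big rowclass predT) //=.
rewrite -[X in (_ <= X * _)%N]card_ord -sum_nat_const.
apply: leq_sum => j _; case: (pickP (fun a => rowclass a == j)) => [a /eqP <-|none].
  rewrite sum1_card; pose f (a : rowix A) := #|[set a' | comm_row g a' == comm_row g a]%SET|.
  apply: (@leq_trans (f a)); last exact: (leq_bigmax (F := f) a).
  apply/subset_leq_card/fintype.subsetP => a'.
  by rewrite unfold_in inE -!rowclassP => /eqP ->.
by rewrite big_pred0.
Qed.

Lemma mult_gt0 : (0 < mult A g)%N.
Proof. by have := rows_mult; case: (mult A g) => //; rewrite muln0 leqn0 expn_eq0. Qed.

(** The restrictions of [g] to the parts of a partition of the cube are pairwise orthogonal and sum
    to [g]. *)
Lemma Pplus_leq_partition (r : nat) (p : cube n -> 'I_r) :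
  (forall j, set_rectangle A (fun x => (p x == j) * g x)%N) ->
  (Pplus_set g A <= r)%N.
Proof.
move=> rect; apply: least_leq; exists (fun j x => (p x == j) * g x)%N; split=> //.
  move=> i j ij x; case: eqP => [->|]; last by rewrite !mul0n.
  by rewrite (negbTE ij) mul0n muln0.
move=> x; rewrite (bigD1 (p x)) //= eqxx mul1n big1 ?addn0 // => i.
by rewrite eq_sym => /negbTE ->.
Qed.

(** On a class of equal rows, [g] is the indicator of the class times the common row. *)
Lemma Pplus_leq_nrows : (Pplus_set g A <= nrows A g)%N.
Proof.
apply: (Pplus_leq_partition (p := fun x => rowclass (rowpart A x))) => j.
exists (fun a => rowclass a == j), (nth [ffun=> 0%N] rows j) => a b.
rewrite /Defs.comm_mx rowpart_glue; case: eqP => [<-|]; last by rewrite !mul0n.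
by rewrite rowclassP ffunE.
Qed.

End Rows.

(** * Row and rectangle bounds for Boolean matrices *)

Section BooleanRows.
Context {n : nat} (A : {set 'I_n}) (f : bfun n).

Lemma nrows_leq_tower : (nrows A (natf f) <= 2 ^ 2 ^ (n - #|A|))%N.
Proof.
rewrite -card_colix -[X in (_ <= X ^ _)%N]card_bool -card_ffun.
apply: (nrows_leq (psi := fun a => [ffun b => f (Defs.glue a b)])
  (h := fun w => [ffun b => nat_of_bool (w b)])) => a.
by apply/ffunP => b; rewrite !ffunE.
Qed.

(** Each single column is a rectangle: as [f] is Boolean, the column itself can serve as the 0/1 row
    factor. *)
Lemma Pplus_leq_col : (Pplus_set (natf f) A <= 2 ^ (n - #|A|))%N.
Proof.
rewrite -card_colix.
apply: (Pplus_leq_partition (p := fun x => enum_rank (colpart A x))) => j.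
exists (fun a => f (Defs.glue a (enum_val j))), (fun b => b == enum_val j) => a b.
rewrite /Defs.comm_mx colpart_glue -(inj_eq enum_val_inj) enum_rankK mulnC.
by case: eqP => [->|]; rewrite ?muln0.
Qed.

(** If the rectangles of an optimal cover are products of g_i and h_i, then row a is determined by
    the set of i with g_i(a) = 1. *)
Lemma nrows_leq_exp_cplxC : (nrows A (natf f) <= 2 ^ cplxC_set f A)%N.
Proof.
have [/leastP[[F [rectF fE]] _] _ _ _] := decomposition_exists A f (natf f).
have gh_ex i : exists gh : (rowix A -> bool) * (colix A -> nat), forall a b,
    Defs.comm_mx (A := A) (natf (F i)) a b = (gh.1 a * gh.2 b)%N.
  by have [g [h]] := rectF i; exists (g, h).
have [gh ghE] := boolp.choice gh_ex.
rewrite -[X in (_ <= _ ^ X)%N]card_ord -[X in (_ <= X ^ _)%N]card_bool -card_ffun.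
apply: (nrows_leq (psi := fun a => [ffun i => (gh i).1 a])
  (h := fun w => [ffun b => nat_of_bool [exists i, w i && (0 < (gh i).2 b)%N]])) => a.
apply/ffunP => b; rewrite !ffunE /Defs.comm_mx /natf fE; congr nat_of_bool.
apply: eq_existsb => i; rewrite ffunE; have := ghE i a b.
by rewrite /Defs.comm_mx /natf; case: (F i _); case: ((gh i).1 a); case: ((gh i).2 b).
Qed.

End BooleanRows.

(** Each summand is at most [f], hence 0/1-valued, and the sum is nonzero exactly where some summand
    is. *)
Lemma or_of_sum_decomposition (n : nat) (rect : (cube n -> nat) -> Prop) (f : bfun n)
  (r : nat) : sum_decompositions rect (natf f) r -> or_decompositions rect f r.
Proof.
move=> [F [rectF _ fE]]; exists (fun i => [ffun x => (0 < F i x)%N]); split.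
  move=> i; suff -> : natf [ffun x => (0 < F i x)%N] = F i by [].
  apply: funext => x; rewrite /natf ffunE.
  suff : (F i x <= 1)%N by case: (F i x) => [|[]].
  by apply: leq_trans (leq_b1 (f x)); have := fE x;
    rewrite /natf (bigD1 i) //= => ->; exact: leq_addr.
move=> x; have := fE x; rewrite /natf => fxE.
apply/idP/existsP => [fx|[i]]; last first.
  rewrite ffunE => Fi; case: (f x) fxE => // /esym/eqP.
  by rewrite sum_nat_eq0 => /forallP/(_ i) /=; rewrite -leqn0 leqNgt Fi.
apply/existsP; apply: contraPT fxE; rewrite negb_exists fx => /forallP F0.
rewrite big1 // => i _; have := F0 i.
by rewrite ffunE -leqNgt leqn0 => /eqP.
Qed.

(** * Comparisons between the hatted and unhatted measures *)

Section Comparisons.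
Context {n : nat} (f : bfun n).

Lemma cplxC_card_leq_set (A : {set 'I_n}) : (cplxC_card f #|A| <= cplxC_set f A)%N.
Proof.
have [ne _ _ _] := decomposition_exists A f (natf f).
apply: leq_least ne _ => r [F [rectF fE]]; apply: least_leq; exists F; split=> // i.
by exists A.
Qed.

Lemma Pplus_card_leq_set (g : cube n -> nat) (A : {set 'I_n}) :
  (Pplus_card g #|A| <= Pplus_set g A)%N.
Proof.
have [_ _ ne _] := decomposition_exists A f g.
apply: leq_least ne _ => r [F [rectF orth gE]]; apply: least_leq; exists F; split=> // i.
by exists A.
Qed.

Lemma cplxC_set_leq_Pplus (A : {set 'I_n}) :
  (cplxC_set f A <= Pplus_set (natf f) A)%N.
Proof.
have [_ _ ne _] := decomposition_exists A f (natf f).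
by apply: leq_least ne _ => r /or_of_sum_decomposition; exact: least_leq.
Qed.

Lemma cplxC_card_leq_Pplus (k : nat) : (k <= n)%N ->
  (cplxC_card f k <= Pplus_card (natf f) k)%N.
Proof.
move=> /exists_card_set[A <-]; have [_ _ _ ne] := decomposition_exists A f (natf f).
by apply: leq_least ne _ => r /or_of_sum_decomposition; exact: least_leq.
Qed.

Lemma cplxShat_le_cplxS : cplxShat f <= (cplxS f)%:R.
Proof.
rewrite /cplxShat big_nat; apply: bigmax_le => [|k /andP[k0 kn]]; first exact: ler0n.
(* A set minimising [nrows] is also a candidate in the minimum of 2^k / [mult], and there
   [rows_mult] compares the two. *)
have [[A Ak SA] _] := min_cardP (fun A => nrows A (natf f)) kn.
apply: le_trans ((min_cardP (fun A => 2 ^+ k / (mult A (natf f))%:R : rat) kn).2 A Ak) _.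
rewrite ler_pdivrMr ?ltr0n ?mult_gt0 // -natrX -natrM ler_nat -Ak.
apply: leq_trans (rows_mult A (natf f)) _; rewrite leq_mul2r; apply/orP; right.
rewrite -SA; apply: (leq_max_nat (fun k => min_card k (fun A => nrows A (natf f)))).
by rewrite k0.
Qed.

Lemma cplxChat_leq_cplxC : (cplxChat f <= cplxC f)%N.
Proof.
apply: max_nat_leq => k /[dup] k1n /andP[_ kn].
have [[A Ak CA] _] := min_cardP (cplxC_set f) kn.
apply: leq_trans (leq_max_nat (fun k => min_card k (cplxC_set f)) k1n).
by rewrite CA -Ak cplxC_card_leq_set.
Qed.

Lemma cplxPhat_leq_cplxP : (cplxPhat f <= cplxP f)%N.
Proof.
pose F A := (Pplus_set (natf f) A + Pplus_set (natf (negf f)) A)%N.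
rewrite /cplxPhat geq_max; apply/andP; split; apply: max_nat_leq => k k1n;
  (have [_ kn] := andP k1n; have [[A Ak PA] _] := min_cardP F kn;
   apply: leq_trans (leq_max_nat (fun k => min_card k F) k1n);
   rewrite PA -Ak; apply: leq_trans (Pplus_card_leq_set _ A) _).
  exact: leq_addr.
exact: leq_addl.
Qed.

Lemma cplxChat_leq_cplxPhat : (cplxChat f <= cplxPhat f)%N.
Proof.
rewrite leq_max; apply/orP; left; apply: max_nat_leq => k /[dup] k1n /andP[_ kn].
apply: leq_trans (leq_max_nat (Pplus_card (natf f)) k1n).
exact: cplxC_card_leq_Pplus.
Qed.

Lemma cplxC_leq_cplxP : (cplxC f <= cplxP f)%N.
Proof.
apply: (le_min_max (G := fun=> cplxC_set f)) => _ A _.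
exact: leq_trans (cplxC_set_leq_Pplus A) (leq_addr _ _).
Qed.

End Comparisons.

(** * Bounds on P, and S against C *)

(** Complementing entries turns equal rows of [f] into equal rows of its negation. *)
Lemma nrows_negf (n : nat) (f : bfun n) (A : {set 'I_n}) :
  (nrows A (natf (negf f)) <= nrows A (natf f))%N.
Proof.
rewrite -[X in (_ <= X)%N]card_ord.
pose h (r : {ffun colix A -> nat}) : {ffun colix A -> nat} := [ffun b => (1 - r b)%N].
apply: (nrows_leq (psi := @rowclass n A (natf f)) (h := fun j => h (nth [ffun=> 0%N]
  (undup [seq comm_row (natf f) a | a : rowix A]) j))) => a.
rewrite rowclassP; apply/ffunP => b; rewrite !ffunE /Defs.comm_mx /natf ffunE.
by case: (f _).
Qed.

Lemma cplxP_leq_double_cplxS (n : nat) (f : bfun n) : (cplxP f <= (cplxS f).*2)%N.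
Proof.
apply: max_nat_leq => k /[dup] k1n /andP[_ kn].
have [[A Ak SA] _] := min_cardP (fun A => nrows A (natf f)) kn.
apply: leq_trans (min_card_leq _ Ak) _.
have nS : (nrows A (natf f) <= cplxS f)%N.
  by rewrite -SA; exact: (leq_max_nat (fun k => min_card k (fun A => nrows A (natf f)))).
rewrite -addnn leq_add //; apply: leq_trans (Pplus_leq_nrows A _) _ => //.
exact: leq_trans (nrows_negf f A) nS.
Qed.

Lemma cplxS_leq_exp_cplxC (n : nat) (f : bfun n) : (cplxS f <= 2 ^ cplxC f)%N.
Proof.
apply: max_nat_leq => k /[dup] k1n /andP[_ kn].
have [[A Ak CA] _] := min_cardP (cplxC_set f) kn.
apply: leq_trans (min_card_leq _ Ak) (leq_trans (nrows_leq_exp_cplxC A f) _).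
rewrite leq_exp2l // -CA.
exact: (leq_max_nat (fun k => min_card k (cplxC_set f))).
Qed.

(** Split by rows when k is at most half of n, and by columns otherwise. *)
Lemma cplxP_leq_exp_half (n : nat) (f : bfun n) : (cplxP f <= 2 * 2 ^ n./2)%N.
Proof.
apply: max_nat_leq => k /[dup] k1n /andP[_ kn]; have [A Ak] := exists_card_set kn.
apply: leq_trans (min_card_leq _ Ak) _; rewrite mul2n -addnn.
suff half h : (Pplus_set (natf h) A <= 2 ^ n./2)%N by rewrite leq_add.
have [kh|kh] := leqP k n./2.
  apply: leq_trans (Pplus_leq_nrows A _) (leq_trans (nrows_leq_row A _) _).
  by rewrite Ak leq_exp2l.
apply: leq_trans (Pplus_leq_col A h) _; rewrite Ak leq_exp2l //.
(* Here k is at least [n./2] + 1, so n - k is at most [n./2] for both parities of n. *)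
by rewrite leq_subLR -{1}(odd_double_half n) -addnn addnA leq_add2r; case: odd => //=;
  rewrite ltnW.
Qed.

(** * Counting functions with a repeated row *)

(** Union bound in multiplied-out form, which avoids division: each event has size at most m/c. *)
Lemma card_bigcup_mul_leq (I T : finType) (P : pred I) (F : I -> {set T}) (c m : nat) :
  (forall i, P i -> #|F i| * c <= m)%N ->
  (#|\bigcup_(i | P i) F i|%SET * c <= #|I| * m)%N.
Proof.
move=> Fm; have [-> |c_gt0] := posnP c; first by rewrite muln0.
apply: (@leq_trans (\sum_(i | P i) #|F i| * c)%N).
  rewrite -big_distrl leq_mul2r /=; apply/orP; right.
  elim/big_ind2: _ => [|m1 X m2 Y Xm Ym|//]; first by rewrite cards0.
  exact: leq_trans (leq_card_setU X Y).1 (leq_add Xm Ym).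
apply: (@leq_trans (\sum_(i | P i) m)); first exact: leq_sum.
by rewrite sum_nat_cond_const leq_mul2r max_card orbT.
Qed.

Section Collisions.
Context {n : nat} (A : {set 'I_n}).

Definition collisions (a a' : rowix A) : {set bfun n} :=
  [set f | comm_row (natf f) a == comm_row (natf f) a']%SET.

(* Overwriting row a of f by an arbitrary row loses nothing on collisions a a':
   the old row a can be read off row a'. *)
Lemma card_collisions (a a' : rowix A) : a != a' ->
  (#|collisions a a'| * 2 ^ 2 ^ (n - #|A|) <= 2 ^ 2 ^ n)%N.
Proof.
move=> aa'; rewrite -(card_bfun n) -card_colix -[X in (_ * X ^ _)%N]card_bool -card_ffun.
rewrite -[X in (_ * X)%N]cardsT -cardsX.
pose phi (p : bfun n * {ffun colix A -> bool}) : bfun n :=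
  [ffun x => if rowpart A x == a then p.2 (colpart A x) else p.1 x].
rewrite -(@card_in_imset _ _ phi) ?max_card // => -[f h] [f' h'].
rewrite !inE !andbT /= => /eqP/ffunP fa /eqP/ffunP fa' /ffunP e.
have row (g : bfun n) b : comm_row (natf g) a b = comm_row (natf g) a' b ->
    g (Defs.glue a b) = g (Defs.glue a' b).
  by rewrite !ffunE /Defs.comm_mx /natf; do 2 case: (g _).
have -> : h = h'.
  apply/ffunP => b; have := e (Defs.glue a b).
  by rewrite !ffunE rowpart_glue eqxx colpart_glue.
congr pair; apply/ffunP => x.
have [xa|xa] := eqVneq (rowpart A x) a; last first.
  by have := e x; rewrite !ffunE (negbTE xa).
rewrite -(glue_parts A x) xa !row //.
by have := e (Defs.glue a' (colpart A x)); rewrite !ffunE rowpart_glue eq_sym (negbTE aa').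
Qed.

Lemma mult_le1 (f : bfun n) :
  (forall a a' : rowix A, a != a' -> f \notin collisions a a') ->
  (mult A (natf f) <= 1)%N.
Proof.
move=> noc; apply/bigmax_leqP => a _; rewrite -(cards1 a); apply/subset_leq_card.
apply/fintype.subsetP => a'; rewrite !inE; apply: contraLR => a'a.
by have := noc a' a a'a; rewrite inE.
Qed.

End Collisions.

(** The exceptional set for part (4): outside it, every f_A with |A| = k has pairwise distinct
    rows. *)
Definition some_collision (n k : nat) : {set bfun n} :=
  (\bigcup_(A : {set 'I_n} | #|A| == k)
     \bigcup_(p : rowix A * rowix A | p.1 != p.2) collisions p.1 p.2)%SET.

(** Union bound over at most 2^n sets A and 2^(2k) ordered pairs of rows, each pair colliding with
    density at most 2^-(2^(n-k)). *)
Lemma card_some_collision (n k : nat) :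
  (#|some_collision n k| * 2 ^ 2 ^ (n - k) <= 2 ^ (n + (k + k) + 2 ^ n))%N.
Proof.
rewrite -addnA 2!expnD -[X in (2 ^ X * _)%N]card_ord.
rewrite -[X in (X ^ _ * _)%N]card_bool -card_ffun.
have -> : #|{: {ffun 'I_n -> bool}}| = #|{: {set 'I_n}}|.
  by rewrite card_ffun card_bool card_ord -cardsT -powersetT card_powerset cardsT card_ord.
apply: card_bigcup_mul_leq => A /eqP Ak.
have -> : (2 ^ (k + k))%N = #|{: rowix A * rowix A}|.
  by rewrite card_prod card_rowix Ak expnD.
by apply: card_bigcup_mul_leq => p; rewrite -Ak; exact: card_collisions.
Qed.

(** With all rows distinct [mult] is 1, so every set of size k gives a quotient of at least 2^k. *)
Lemma cplxShat_ge (n k : nat) (f : bfun n) : (0 < k <= n)%N ->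
  f \notin some_collision n k ->
  2 ^+ k <= cplxShat f.
Proof.
move=> k1n fB; have [_ kn] := andP k1n.
pose F (k : nat) (A : {set 'I_n}) : rat := 2 ^+ k / (mult A (natf f))%:R.
apply: (@le_trans _ _ (min_card k (F k))); last first.
  by apply: (@le_bigmax_seq _ _ _ _ _ _ _ (fun k => min_card k (F k)));
    rewrite ?mem_index_iota.
have [[A Ak ->] _] := min_cardP (F k) kn.
rewrite ler_pdivlMr ?ltr0n ?mult_gt0 // ler_piMr ?exprn_ge0 //.
rewrite -[leRHS]/(1%:R) ler_nat; apply: mult_le1 => a a' aa'.
apply: contra fB => fc; apply/bigcupP; exists A; first exact/eqP.
by apply/bigcupP; exists (a, a').
Qed.

(** * Counting disjunctions of few rectangles *)

Section OrCount.
Context (n k : nat).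

Definition bool_rectangles : {set bfun n} :=
  [set h | `[< card_rectangle k (natf h) >]]%SET.

(** There are at most 2^n choices of A, 2^(2^k) row factors and 2^(2^(n-k)) Boolean column
    factors. *)
Lemma card_bool_rectangles : (#|bool_rectangles| <= 2 ^ (n + (2 ^ k + 2 ^ (n - k))))%N.
Proof.
pose rect (A : {set 'I_n}) (p : {ffun rowix A -> bool} * {ffun colix A -> bool}) : bfun n :=
  [ffun x => p.1 (rowpart A x) && p.2 (colpart A x)].
pose U := (\bigcup_(A : {set 'I_n} | #|A| == k) [set rect A p | p in predT])%SET.
apply: (@leq_trans #|U|).
  apply/subset_leq_card/fintype.subsetP => h; rewrite inE => /asboolP[A Ak [p [q hpq]]].
  apply/bigcupP; exists A; first exact/eqP.
  (* The product is 0/1-valued, so replacing the natural-valued column factor by its positivity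
     leaves it unchanged. *)
  apply/imsetP; exists ([ffun a => p a], [ffun b => (0 < q b)%N]) => //.
  apply/ffunP => x; rewrite !ffunE /= -{1}(glue_parts A x).
  have := hpq (rowpart A x) (colpart A x); rewrite /Defs.comm_mx /natf.
  by case: (h _); case: (p _); case: (q _).
rewrite -[#|U|]muln1 expnD -[X in (2 ^ X * _)%N]card_ord.
rewrite -cardsT -card_powerset powersetT cardsT.
apply: card_bigcup_mul_leq => A /eqP Ak; rewrite muln1.
apply: leq_trans (leq_imset_card _ _) _.
apply: leq_trans (max_card _) _; rewrite card_prod card_ffun card_rowix.
by rewrite [X in (_ * X)%N]card_ffun card_colix card_bool Ak expnD.
Qed.

Lemma card_cplxC_card_leq (T : nat) : (k <= n)%N ->
  (#|[set f : bfun n | (cplxC_card f k <= T)%N]%SET| <=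
   2 ^ ((n + (2 ^ k + 2 ^ (n - k))) * T))%N.
Proof.
move=> kn; rewrite expnM; apply: (@leq_trans (#|bool_rectangles| ^ T)); last first.
  by have [->|T_gt0] := posnP T; rewrite ?expn0 // leq_exp2r ?card_bool_rectangles.
rewrite -[X in (_ ^ X)%N]card_ord -card_ffun_on.
pose disj (F : {ffun 'I_T -> bfun n}) : bfun n := [ffun x => [exists i, F i x]].
apply: leq_trans (leq_imset_card disj _).
apply/subset_leq_card/fintype.subsetP => f; rewrite inE => CT.
have [A Ak] := exists_card_set kn.
have [_ + _ _] := decomposition_exists A f (natf f); rewrite Ak => /leastP[].
rewrite -/(cplxC_card f k) => -[F [rectF fE]] _.
(* A shorter decomposition is padded to exactly T rectangles with the zero function, which is itself
   a k-rectangle. *)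
pose G (i : 'I_T) : bfun n := if insub (val i) is Some j then F j else [ffun=> false].
apply/imsetP; exists [ffun i => G i].
  apply/ffun_onP => i; rewrite ffunE inE; apply/asboolP; rewrite /G.
  case: insubP => [j _ _|_]; first exact: rectF.
  exists A => //; exists (fun=> false), (fun=> 0%N) => a b.
  by rewrite /Defs.comm_mx /natf ffunE.
apply/ffunP => x; rewrite ffunE fE; apply/existsP/existsP => -[i].
  exists (widen_ord CT i); rewrite ffunE /G /=.
  by rewrite (_ : insub _ = Some i) //; exact: valK.
rewrite ffunE /G; case: insubP => [j _ _ Fj|_]; last by rewrite ffunE.
by exists j.
Qed.

End OrCount.

Lemma card_cplxC_card_half (n : nat) : (6 <= n)%N ->
  (#|[set f : bfun n | (cplxC_card f n./2 <= 2 ^ (n./2 - 3))%N]%SET| * 2 ^ n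
   <= 2 ^ 2 ^ n)%N.
Proof.
move=> n6; have nE := odd_double_half n; rewrite -addnn in nE.
have kn : (n./2 <= n)%N by lia.
apply: (@leq_trans (2 ^ ((n + (2 ^ n./2 + 2 ^ (n - n./2))) * 2 ^ (n./2 - 3)) * 2 ^ n)).
  by rewrite leq_mul2r card_cplxC_card_leq ?orbT.
rewrite -expnD leq_exp2l //.
(* With m = n - [n./2], both powers are at most 2^m, and n is at most 2m, hence below 2 * 2^m. *)
have M4 : (n + (2 ^ n./2 + 2 ^ (n - n./2)) <= 2 ^ (n - n./2 + 2))%N.
  have kM : (2 ^ n./2 <= 2 ^ (n - n./2))%N by rewrite leq_exp2l //; lia.
  have := ltn_expl (n - n./2) (isT : 1 < 2)%N; rewrite expnD; lia.
apply: (@leq_trans (2 ^ (n - n./2 + 2) * 2 ^ (n./2 - 3) + n)).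
  by rewrite leq_add2r leq_mul2r M4 orbT.
(* The threshold 2^([n./2] - 3) is chosen so that this exponent is n - 1; the other half of 2^n
   absorbs the summand n. The subtraction of 3 is exact because n is at least 6. *)
rewrite -expnD (_ : n - n./2 + 2 + (n./2 - 3) = n.-1)%N; last by lia.
have -> : (2 ^ n = 2 * 2 ^ n.-1)%N by rewrite -expnS prednK //; lia.
have := ltn_expl n.-1 (isT : 1 < 2)%N; lia.
Qed.

(** * Statements about most functions *)

(** An exceptional set of density at most 2^-n squeezes the density of [Q n] between 1 - 2^-n and
    1. *)
Lemma most_of_rare (R : realType) (Q : forall n, pred (bfun n)) :
  (\forall n \near \oo%classic, exists2 B : {set bfun n},
     (#|B| * 2 ^ n <= 2 ^ 2 ^ n)%N & forall f, f \notin B -> Q n f) ->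
  most R Q.
Proof.
move=> rare; apply: (@squeeze_cvgr _ _ _ _ (fun n => 1 - 2^-1 ^+ n) (fun=> 1)).
- apply: filterS rare => n [B cardB BQ].
  have tot_gt0 : 0 < #|{: bfun n}|%:R :> R by rewrite card_bfun ltr0n expn_gt0.
  rewrite ler_pdivlMr // ler_pdivrMr // mul1r ler_nat max_card andbT.
  have tot_le : (#|{: bfun n}| <= #|B| + #|Q n|)%N.
    rewrite -(cardC (mem B)) leq_add2l; apply/subset_leq_card/fintype.subsetP => f.
    by rewrite !inE; exact: BQ.
  have BR : #|B|%:R * 2 ^+ n <= #|{: bfun n}|%:R :> R.
    by rewrite -natrX -natrM ler_nat card_bfun.
  rewrite mulrBl mul1r lerBlDr exprVn mulrC -lerBlDl.
  rewrite ler_pdivlMr ?exprn_gt0 //; apply: le_trans BR.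
  rewrite ler_pM2r ?exprn_gt0 // lerBlDr -natrD ler_nat //.
- rewrite -[X in (_ --> X)%classic]subr0; apply: cvgB; first exact: cvg_cst.
  by apply: cvg_expr; rewrite ger0_norm ?invr_ge0 // invf_lt1 ?ltr1n.
- exact: cvg_cst.
Qed.

Lemma most_cplxShat_ge (R : realType) (delta : R) : 1 < delta ->
  most R (fun n f => 2 ^+ n / n%:R `^ delta <= ratr (cplxShat f)).
Proof.
move=> delta1; apply: most_of_rare.
apply: filterS2 (nbhs_infty_ge 6) (nbhs_infty_ger (8 `^ (delta - 1)^-1)) => n n6 n_large.
have n_gt0 : (0 < n)%N by apply: leq_trans n6.
(* From n >= 8^(1/(delta-1)) one gets n^(delta-1) >= 8; this absorbs the factor 8 in 2^j < 8n. *)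
have n8 : 8 * n%:R <= n%:R `^ delta :> R.
  rewrite -(subrK 1 delta) powRD ?pnatr_eq0 -?lt0n ?n_gt0 ?implybT // powRr1 //.
  rewrite ler_pM2r ?ltr0n //.
  have : (8 `^ (delta - 1)^-1) `^ (delta - 1) <= n%:R `^ (delta - 1).
    by apply: ge0_ler_powR; rewrite ?nnegrE ?powR_ge0 ?subr_ge0 ?ler0n // ltW.
  by rewrite -powRrM mulVf ?powRr1 // subr_eq0 gt_eqF.
set j := up_log 2 (4 * n).
have [jl ju] : (2 ^ j < 8 * n /\ 4 * n <= 2 ^ j)%N.
  have /andP[] := @up_log_bounds 2 (4 * n) isT ltac:(lia).
  rewrite -/j; case: j => [|j] /=; first by lia.
  by rewrite expnS; lia.
have n8exp : (8 * n <= 2 ^ n)%N.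
  rewrite -(subnK n6) expnD; elim: (n - 6)%N => [//|m IH]; rewrite (expnS 2 m) -mulnA; lia.
have jn : (j < n)%N by rewrite -(ltn_exp2l _ _ (isT : 1 < 2)%N); exact: leq_trans jl n8exp.
have k1n : (0 < n - j <= n)%N by lia.
exists (some_collision n (n - j)).
  have := card_some_collision n (n - j).
  rewrite subKn ?(ltnW jn) // -(leq_pmul2r (expn_gt0 2 n)) => card_B.
  rewrite -(leq_pmul2r (expn_gt0 2 (2 ^ j))) mulnAC (leq_trans card_B) //.
  (* The exponents require 2n + 2(n - j) <= 2^j, which is why j was chosen with 4n <= 2^j. *)
  by rewrite -!expnD leq_exp2l //; lia.
move=> f /(cplxShat_ge k1n) Sk.
apply: (@le_trans _ _ (ratr (2 ^+ (n - j) : rat))); last by rewrite ler_rat.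
rewrite rmorphXn /= ratr_nat ler_pdivrMr ?powR_gt0 ?ltr0n //.
rewrite -{1}(subnK (ltnW jn)) exprD ler_pM2l ?exprn_gt0 //.
apply: le_trans n8; rewrite -natrX -natrM ler_nat; exact: ltnW.
Qed.

Lemma most_cplxChat_ge (R : realType) :
  most R (fun n f => (16^-1 : R) * (2 `^ (n%:R / 2) / log2 n%:R) <= (cplxChat f)%:R).
Proof.
apply: most_of_rare; apply: filterS (nbhs_infty_ge 6) => n n6.
exists [set f : bfun n | (cplxC_card f n./2 <= 2 ^ (n./2 - 3))%N]%SET.
  exact: card_cplxC_card_half.
move=> f; rewrite inE -ltnNge => TC.
have nE := odd_double_half n; rewrite -addnn in nE.
have TChat : (2 ^ (n./2 - 3) <= cplxChat f)%N.
  apply: leq_trans (ltnW TC) (leq_max_nat (cplxC_card f) _); lia.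
apply: (@le_trans _ _ (2 ^ (n./2 - 3))%:R); last by rewrite ler_nat.
have half : 2 `^ (n%:R / 2) <= 2 ^+ (n./2.+1) :> R.
  rewrite -powR_mulrn // ler_powR ?ler1n // ler_pdivrMr // -natrM ler_nat; lia.
(* Since log n is at least 1, dividing by it only weakens the bound. *)
have log_ge1 : 1 <= log2 n%:R :> R.
  have ln2 : 0 < ln 2 :> R by rewrite ln_gt0 ?ltr1n.
  by rewrite /log2 ler_pdivlMr // mul1r ler_ln ?posrE ?ltr0n ?ler_nat; lia.
have : 2 `^ (n%:R / 2) / log2 n%:R <= 2 ^+ (n./2.+1) :> R.
  apply: le_trans half; rewrite ler_pdivrMr ?(lt_le_trans ltr01) //.
  by rewrite ler_peMr ?powR_ge0.
(* The constant 16 = 2^4 bridges 2^([n./2] + 1), an upper bound for 2^(n/2), and the threshold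
   2^([n./2] - 3). *)
move=> le_exp; rewrite mulrC ler_pdivrMr //; apply: le_trans le_exp _.
rewrite -natrX -natrM ler_nat -[16%N]/(2 ^ 4)%N -expnD leq_exp2l //; lia.
Qed.

(** * The upper bound on S and the final assembly *)

Lemma sqr_leq_exp (n : nat) : (n ^ 2 <= 4 * 2 ^ n)%N.
Proof.
(* Small cases are computed; from m = 4 on, (m+1)^2 <= 2 m^2 drives the induction. *)
do 4 (case: n => [//|n]); elim: n => [//|n IH].
by rewrite [X in (_ <= 4 * X)%N]expnS mulnCA (leq_trans _ (leq_mul (leqnn 2) IH)) //; nia.
Qed.

(** If 2^(n-k) >= n/2, the bound of 2^k rows suffices. Otherwise there are at most 2^(n/2) rows,
    since 2^(2^(n-k)) bounds them, and n <= 2 * 2^(n/2). *)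
Lemma cplxS_leq (n : nat) (f : bfun n) : (cplxS f * n <= 2 * 2 ^ n)%N.
Proof.
have [n0|n_gt0] := posnP n; first by rewrite {2}n0 muln0.
rewrite -leq_divRL //; apply: max_nat_leq => k /[dup] k1n /andP[_ kn].
have [A Ak] := exists_card_set kn; apply: leq_trans (min_card_leq _ Ak) _.
rewrite leq_divRL //; have [nk|nk] := leqP n (2 * 2 ^ (n - k)).
  apply: leq_trans (leq_mul (nrows_leq_row A _) nk) _.
  by rewrite Ak mulnCA -expnD subnKC.
apply: leq_trans (leq_mul (nrows_leq_tower A f) (leqnn n)) _; rewrite Ak.
(* Squaring both sides avoids the half-integer exponent n/2. *)
rewrite -leq_sqr expnMn -[X in (X * _)%N]expnM.
apply: (@leq_trans (2 ^ n * (4 * 2 ^ n))); last by rewrite expnMn -expnM muln2 -addnn expnD mulnCA.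
by rewrite leq_mul ?sqr_leq_exp // leq_exp2l // mulnC ltnW.
Qed.

Theorem theorem3p7 (R : realType) :
  (* 1 *)
  (forall (n : nat) (f : bfun n), (0 < n)%N ->
     [/\ cplxShat f <= (cplxS f)%:R,
         (cplxChat f <= cplxC f)%N,
         (cplxPhat f <= cplxP f)%N,
         (cplxChat f <= cplxPhat f)%N
       & (cplxC f <= cplxP f)%N]) /\
  (* 2 *)
  (forall (n : nat) (f : bfun n), (0 < n)%N ->
     ((cplxP f)%:R / 2 <= (cplxS f)%:R :> R) /\
     (cplxS f <= 2 ^ cplxC f)%N) /\
  (* 3 *)
  ((exists c : R, 0 < c /\
      forall (n : nat) (f : bfun n), (0 < n)%N ->
        (cplxS f)%:R <= c * (2 ^+ n / n%:R)) /\
   (forall (n : nat) (f : bfun n), (0 < n)%N ->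
      (cplxP f)%:R <= (2 : R) `^ (n%:R / 2 + 1))) /\
  (* 4 *)
  (forall delta : R, 1 < delta ->
     most R (fun n f => 2 ^+ n / n%:R `^ delta <= ratr (cplxShat f))) /\
  (* 5 *)
  (exists c : R, 0 < c /\
     most R (fun n f =>
       c * (2 `^ (n%:R / 2) / log2 n%:R) <= (cplxChat f)%:R)).
Proof.
split=> [n f _|].
  split; [exact: cplxShat_le_cplxS | exact: cplxChat_leq_cplxC | exact: cplxPhat_leq_cplxP
    | exact: cplxChat_leq_cplxPhat | exact: cplxC_leq_cplxP].
split=> [n f _|].
  split; last exact: cplxS_leq_exp_cplxC.
  by rewrite ler_pdivrMr // -natrM ler_nat muln2 cplxP_leq_double_cplxS.
split.
  split=> [|n f _].
    exists 2; split=> // n f n_gt0.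
    by rewrite mulrA ler_pdivlMr ?ltr0n // -natrX -!natrM ler_nat cplxS_leq.
  rewrite powRD ?pnatr_eq0 ?implybT // powRr1 // mulrC.
  apply: (@le_trans _ _ (2 * 2 ^+ n./2)).
    by rewrite -natrX -natrM ler_nat cplxP_leq_exp_half.
  rewrite ler_pM2l // -powR_mulrn // ler_powR ?ler1n // ler_pdivlMr // -natrM ler_nat.
  by rewrite muln2 -{2}(odd_double_half n) leq_addl.
split=> [delta|]; first exact: most_cplxShat_ge.
by exists 16^-1; split; [rewrite invr_gt0 | exact: most_cplxChat_ge].
Qed.
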